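(* Let $A$ be an algebra in a (strict) monoidal category $\mathcal{C}$ whose full centre $(Z(A),\zeta)$ exists, where $\zeta:Z(A)\to A$ is the structure morphism in $\mathcal{C}$. Then $Z(A)$ has a unique structure of an algebra in the monoidal centre $\mathcal{Z}(\mathcal{C})$ such that $\zeta:Z(A)\to A$ is a homomorphism of algebras in $\mathcal{C}$. Moreover, with this structure $Z(A)$ is a commutative algebra in the braided monoidal category $\mathcal{Z}(\mathcal{C})$.
   Context: Monoidal categories are assumed strict. An algebra in $\mathcal{C}$ is an associative unital algebra object $(A,\mu,\iota)$ with $\mu:A\otimes A\to A$ and $\iota:I\to A$; homomorphisms are unital. Monoidal centre: $\mathcal{Z}(\mathcal{C})$ is the category of pairs $(Z,z)$ with $Z\in\mathcal{C}$ and $z_X:Z\otimes X\to X\otimes Z$ a natural family of isomorphisms (half-braiding) with $z_I=1$ and $z_{X\otimes Y}=(X\otimes z_Y)(z_X\otimes Y)$. Morphisms are morphisms of first components in $\mathcal{C}$ compatible with half-braidings. Tensor product: $(Z,z)\otimes(W,w)=(Z\otimes W,z|w)$ with $(z|w)_X=(z_X\otimes W)(Z\otimes w_X)$. Braiding: $c_{(X,x),(Y,y)}=x_Y$. The half-braiding and the forgetful functor $\mathcal{Z}(\mathcal{C})\to\mathcal{C}$ are often suppressed from notation. An algebra $C$ in a braided monoidal category is commutative if $\mu\, c_{C,C}=\mu$. Full centre: the full centre of $A$ is a pair $(Z(A),\zeta)$, with $Z(A)\in\mathcal{Z}(\mathcal{C})$ and $\zeta:Z(A)\to A$ a morphism in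 $\mathcal{C}$, which is terminal among pairs $(Z,\zeta)$ with $Z=(Z,z)\in\mathcal{Z}(\mathcal{C})$ and $\zeta:Z\to A$ a morphism in $\mathcal{C}$ satisfying $\mu(\zeta\otimes A)=\mu(A\otimes\zeta)z_A$ as morphisms $Z\otimes A\to A$. Morphisms of such pairs are morphisms of $\mathcal{Z}(\mathcal{C})$ commuting with the maps to $A$. *)

(* Defs.v *)
From Stdlib Require Import ssreflect ProofIrrelevance FunctionalExtensionality.

Set Implicit Arguments.
Unset Strict Implicit.
Unset Printing Implicit Defensive.

Declare Scope cat_scope.
Delimit Scope cat_scope with cat.
Local Open Scope cat_scope.

Record category := Category {
  Ob :> Type;
  Hom : Ob -> Ob -> Type;
  idm : forall X, Hom X X;
  comp : forall X Y Z, Hom Y Z -> Hom X Y -> Hom X Z;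
  comp_idl : forall X Y (f : Hom X Y), comp (idm Y) f = f;
  comp_idr : forall X Y (f : Hom X Y), comp f (idm X) = f;
  compA : forall W X Y Z (f : Hom Y Z) (g : Hom X Y) (h : Hom W X),
    comp f (comp g h) = comp (comp f g) h
}.
Arguments Hom {c} X Y.
Arguments idm {c} X.
Arguments comp {c X Y Z} g f : rename.

Notation "g ∘ f" := (comp g f) (at level 40, left associativity) : cat_scope.

Definition is_iso (C : category) (X Y : C) (f : Hom X Y) : Prop :=
  exists g : Hom Y X, g ∘ f = idm X /\ f ∘ g = idm Y.

Definition is_terminal (C : category) (T : C) : Prop :=
  forall X : C, exists f : Hom X T, forall g : Hom X T, g = f.

Definition idt (C : category) (X Y : C) (e : X = Y) : Hom X Y :=
  match e with eq_refl => idm X end.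

(* Object equations such as (X ⊗ Y) ⊗ Z = X ⊗ (Y ⊗ Z) do not hold by conversion,
   so the two sides of an equation between morphisms may live in different
   types.  heq is equality of such morphisms, transported along equalities of
   their sources and of their targets (unique, by proof irrelevance). *)
Definition heq (C : category) (X Y X' Y' : C) (f : Hom X Y) (g : Hom X' Y') :
    Prop :=
  exists (p : X' = X) (q : Y = Y'), g = idt q ∘ f ∘ idt p.

Notation "f ≡ g" := (heq f g) (at level 70, no associativity) : cat_scope.

Section Heq.
Variable C : category.
Implicit Types X Y Z : C.

Lemma idt_id X (e : X = X) : idt e = idm X.
Proof. by rewrite (proof_irrelevance _ e eq_refl). Qed.

Lemma heq_refl X Y (f : Hom X Y) : f ≡ f.
Proof. by exists eq_refl, eq_refl; rewrite /= comp_idl comp_idr. Qed.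

Lemma heq_of_eq X Y (f g : Hom X Y) : f = g -> f ≡ g.
Proof. move=> ->; exact: heq_refl. Qed.

Lemma heq_eq X Y (f g : Hom X Y) : f ≡ g -> f = g.
Proof. by case=> p [q ->]; rewrite !idt_id comp_idl comp_idr. Qed.

Lemma heq_sym X Y X' Y' (f : Hom X Y) (g : Hom X' Y') : f ≡ g -> g ≡ f.
Proof.
case=> p [q ->]; destruct p, q; rewrite /= comp_idl comp_idr; exact: heq_refl.
Qed.

Lemma heq_trans X Y X' Y' X'' Y'' (f : Hom X Y) (g : Hom X' Y')
  (h : Hom X'' Y'') : f ≡ g -> g ≡ h -> f ≡ h.
Proof.
case=> p [q ->]; destruct p, q; by rewrite /= comp_idl comp_idr.
Qed.

Lemma heq_comp X Y Z X' Y' Z' (f : Hom X Y) (g : Hom Y Z) (f' : Hom X' Y')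
  (g' : Hom Y' Z') : f ≡ f' -> g ≡ g' -> g ∘ f ≡ g' ∘ f'.
Proof.
case=> p [q ->] [p' [q' ->]]; destruct p, q, q'.
rewrite (idt_id p') /= !comp_idl !comp_idr; exact: heq_refl.
Qed.

Lemma heq_idtl X Y Y' (f : Hom X Y) (e : Y = Y') : idt e ∘ f ≡ f.
Proof. destruct e; rewrite /= comp_idl; exact: heq_refl. Qed.

Lemma heq_idtr X' X Y (f : Hom X Y) (e : X' = X) : f ∘ idt e ≡ f.
Proof. destruct e; rewrite /= comp_idr; exact: heq_refl. Qed.

Lemma idt_heql X Y (e : X = Y) : idt e ≡ idm X.
Proof. destruct e; exact: heq_refl. Qed.

Lemma idt_heqr X Y (e : X = Y) : idt e ≡ idm Y.
Proof. destruct e; exact: heq_refl. Qed.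

Lemma heq_idm X X' : X = X' -> idm X ≡ idm X'.
Proof. move=> ->; exact: heq_refl. Qed.

Lemma heq_comp_idt X Y Y1 Z X' Y' Z' (f : Hom X Y) (g : Hom Y1 Z) (e : Y = Y1)
  (f' : Hom X' Y') (g' : Hom Y' Z') :
  f ≡ f' -> g ≡ g' -> g ∘ idt e ∘ f ≡ g' ∘ f'.
Proof. destruct e; rewrite /= comp_idr; exact: heq_comp. Qed.

Lemma heq_comp_idt2 X Y Y1 Z X' Y' Y1' Z' (f : Hom X Y) (g : Hom Y1 Z)
  (e : Y = Y1) (f' : Hom X' Y') (g' : Hom Y1' Z') (e' : Y' = Y1') :
  f ≡ f' -> g ≡ g' -> g ∘ idt e ∘ f ≡ g' ∘ idt e' ∘ f'.
Proof. destruct e, e'; rewrite /= !comp_idr; exact: heq_comp. Qed.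

Lemma is_iso_idt X Y (e : X = Y) : is_iso (idt e).
Proof. destruct e; exists (idm X); by rewrite /= comp_idl. Qed.

Lemma is_iso_comp X Y Z (g : Hom Y Z) (f : Hom X Y) :
  is_iso g -> is_iso f -> is_iso (g ∘ f).
Proof.
move=> [g' [gl gr]] [f' [fl fr]]; exists (f' ∘ g'); split.
- by rewrite compA -(compA f') gl comp_idr.
- by rewrite compA -(compA g) fr comp_idr.
Qed.

End Heq.

Record strictMonCat := StrictMonCat {
  smc_cat :> category;
  tens : smc_cat -> smc_cat -> smc_cat;
  tensm : forall X X' Y Y' : smc_cat,
    Hom X X' -> Hom Y Y' -> Hom (tens X Y) (tens X' Y');
  unito : smc_cat;
  tensm_id : forall X Y, tensm (idm X) (idm Y) = idm (tens X Y);
  tensm_comp : forall X X' X'' Y Y' Y'' (f' : Hom X' X'') (f : Hom X X')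
    (g' : Hom Y' Y'') (g : Hom Y Y'),
    tensm (f' ∘ f) (g' ∘ g) = tensm f' g' ∘ tensm f g;
  tensA : forall X Y Z, tens (tens X Y) Z = tens X (tens Y Z);
  tens1o : forall X, tens unito X = X;
  tenso1 : forall X, tens X unito = X;
  tensmA : forall X X' Y Y' Z Z' (f : Hom X X') (g : Hom Y Y') (h : Hom Z Z'),
    tensm (tensm f g) h ≡ tensm f (tensm g h);
  tensm1o : forall X X' (f : Hom X X'), tensm (idm unito) f ≡ f;
  tensmo1 : forall X X' (f : Hom X X'), tensm f (idm unito) ≡ f
}.
Arguments tens {s} X Y.
Arguments tensm {s X X' Y Y'} f g.
Arguments unito {s}.

Notation "X ⊗ Y" := (tens X Y) (at level 35, right associativity) : cat_scope.
Notation "f ⊗m g" := (tensm f g) (at level 35, right associativity) : cat_scope.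

(* Identity morphisms, needed only to make composites typecheck. *)
Definition assoc (C : strictMonCat) (X Y Z : C) :
  Hom ((X ⊗ Y) ⊗ Z) (X ⊗ (Y ⊗ Z)) := idt (tensA X Y Z).
Definition assocV (C : strictMonCat) (X Y Z : C) :
  Hom (X ⊗ (Y ⊗ Z)) ((X ⊗ Y) ⊗ Z) := idt (eq_sym (tensA X Y Z)).

Section Monoidal.
Variable C : strictMonCat.
Implicit Types X Y Z W : C.

Lemma heq_tensm X Y X' Y' U V U' V' (f : @Hom C X Y) (f' : @Hom C X' Y')
  (g : @Hom C U V) (g' : @Hom C U' V') : f ≡ f' -> g ≡ g' -> f ⊗m g ≡ f' ⊗m g'.
Proof.
case=> p [q ->] [p' [q' ->]]; destruct p, q, p', q'.
rewrite /= !comp_idl !comp_idr; exact: heq_refl.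
Qed.

Lemma assoc_nat X X' Y Y' Z Z' (f : @Hom C X X') (g : @Hom C Y Y')
  (h : @Hom C Z Z') :
  assoc X' Y' Z' ∘ ((f ⊗m g) ⊗m h) = (f ⊗m (g ⊗m h)) ∘ assoc X Y Z.
Proof.
apply: heq_eq; apply: heq_trans; first exact: heq_idtl.
apply: heq_trans; first exact: tensmA.
apply: heq_sym; exact: heq_idtr.
Qed.

Lemma assocV_nat X X' Y Y' Z Z' (f : @Hom C X X') (g : @Hom C Y Y')
  (h : @Hom C Z Z') :
  assocV X' Y' Z' ∘ (f ⊗m (g ⊗m h)) = ((f ⊗m g) ⊗m h) ∘ assocV X Y Z.
Proof.
apply: heq_eq; apply: heq_trans; first exact: heq_idtl.
apply: heq_trans; first exact: heq_sym (tensmA _ _ _).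
apply: heq_sym; exact: heq_idtr.
Qed.

Lemma is_iso_tensm X X' Y Y' (f : @Hom C X X') (g : @Hom C Y Y') :
  is_iso f -> is_iso g -> is_iso (f ⊗m g).
Proof.
move=> [f' [fl fr]] [g' [gl gr]]; exists (f' ⊗m g').
by rewrite -!tensm_comp fl fr gl gr !tensm_id.
Qed.

Lemma is_iso_idm X : is_iso (idm X).
Proof. exact: (is_iso_idt (eq_refl X)). Qed.

Lemma heq_whiskerr X Y Y' Z (g1 : @Hom C X Y) (e : Y = Y') (g2 : @Hom C Y' Z) W :
  exists e' : Y ⊗ W = Y' ⊗ W,
    (g2 ∘ idt e ∘ g1) ⊗m idm W = (g2 ⊗m idm W) ∘ idt e' ∘ (g1 ⊗m idm W).
Proof.
by destruct e; exists eq_refl; rewrite /= !comp_idr -tensm_comp comp_idl.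
Qed.

Lemma heq_whiskerl X Y Y' Z (g1 : @Hom C X Y) (e : Y = Y') (g2 : @Hom C Y' Z) W :
  exists e' : W ⊗ Y = W ⊗ Y',
    idm W ⊗m (g2 ∘ idt e ∘ g1) = (idm W ⊗m g2) ∘ idt e' ∘ (idm W ⊗m g1).
Proof.
by destruct e; exists eq_refl; rewrite /= !comp_idr -tensm_comp comp_idl.
Qed.

End Monoidal.

Record braiding (C : strictMonCat) := Braiding {
  br :> forall X Y : C, Hom (X ⊗ Y) (Y ⊗ X);
  br_iso : forall X Y, is_iso (br X Y);
  br_nat : forall X X' Y Y' (f : Hom X X') (g : Hom Y Y'),
    (g ⊗m f) ∘ br X Y = br X' Y' ∘ (f ⊗m g);
  br_tensr : forall X Y Z,
    br X (Y ⊗ Z) ≡ (idm Y ⊗m br X Z) ∘ assoc Y X Z ∘ (br X Y ⊗m idm Z);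
  br_tensl : forall X Y Z,
    br (X ⊗ Y) Z ≡ (br X Z ⊗m idm Y) ∘ assocV X Z Y ∘ (idm X ⊗m br Y Z)
}.

Record algStruct (C : strictMonCat) (A : C) := AlgStruct {
  alg_mul : Hom (A ⊗ A) A;
  alg_unit : Hom unito A;
  alg_mulA : alg_mul ∘ (alg_mul ⊗m idm A) ≡ alg_mul ∘ (idm A ⊗m alg_mul);
  alg_mul1l : alg_mul ∘ (alg_unit ⊗m idm A) ≡ idm A;
  alg_mul1r : alg_mul ∘ (idm A ⊗m alg_unit) ≡ idm A
}.

Record algebra (C : strictMonCat) := Algebra {
  alg_ob :> C;
  alg_str : algStruct alg_ob
}.

Definition mul (C : strictMonCat) (A : algebra C) : Hom (A ⊗ A) A :=
  alg_mul (alg_str A).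
Definition one (C : strictMonCat) (A : algebra C) : Hom unito A :=
  alg_unit (alg_str A).

Definition is_alg_hom (C : strictMonCat) (A B : algebra C) (f : Hom A B) :
    Prop :=
  f ∘ mul A = mul B ∘ (f ⊗m f) /\ f ∘ one A = one B.

Definition is_commutative (C : strictMonCat) (c : braiding C) (A : algebra C) :
    Prop :=
  mul A ∘ c A A = mul A.

Record halfBraiding (C : strictMonCat) (Z : C) := HalfBraiding {
  hb :> forall X : C, Hom (Z ⊗ X) (X ⊗ Z);
  hb_iso : forall X, is_iso (hb X);
  hb_nat : forall X Y (f : Hom X Y), (f ⊗m idm Z) ∘ hb X = hb Y ∘ (idm Z ⊗m f);
  hb_unit : hb unito ≡ idm Z;
  hb_tens : forall X Y,
    hb (X ⊗ Y) ≡ (idm X ⊗m hb Y) ∘ assoc X Z Y ∘ (hb X ⊗m idm Y)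
}.

Record centreOb (C : strictMonCat) := CentreOb {
  ce_ob :> C;
  ce_hb : halfBraiding ce_ob
}.

Record centreHom (C : strictMonCat) (Z W : centreOb C) := CentreHom {
  ce_hom :> @Hom C Z W;
  ce_compat : forall X : C,
    (idm X ⊗m ce_hom) ∘ ce_hb Z X = ce_hb W X ∘ (ce_hom ⊗m idm X)
}.

Section CentreCategory.
Variable C : strictMonCat.

Lemma centreHom_eq (Z W : centreOb C) (f g : centreHom Z W) :
  ce_hom f = ce_hom g -> f = g.
Proof.
case: f => f hf; case: g => g hg /= e; destruct e.
by rewrite (proof_irrelevance _ hf hg).
Qed.

Lemma centreOb_eq (Z W : centreOb C) :
  ce_ob Z = ce_ob W -> (forall X, ce_hb Z X ≡ ce_hb W X) -> Z = W.
Proof.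
case: Z => Z z; case: W => W w /= e; destruct e => h.
suff -> : z = w by [].
case: z h => z z1 z2 z3 z4; case: w => w w1 w2 w3 w4 /= h.
have e : z = w by apply: functional_extensionality_dep => X; exact: heq_eq.
destruct e.
by rewrite (proof_irrelevance _ z1 w1) (proof_irrelevance _ z2 w2)
  (proof_irrelevance _ z3 w3) (proof_irrelevance _ z4 w4).
Qed.

Definition centre_id (Z : centreOb C) : centreHom Z Z.
Proof.
by exists (idm (Z : C)) => X; rewrite !tensm_id comp_idl comp_idr.
Defined.

Definition centre_comp (X Y Z : centreOb C) (g : centreHom Y Z)
  (f : centreHom X Y) : centreHom X Z.
Proof.
exists (ce_hom g ∘ ce_hom f) => V.
by rewrite -[idm V]comp_idl !tensm_comp -compA ce_compat compA ce_compat
  -compA.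
Defined.

Definition centreCat : category.
Proof.
refine (@Category (centreOb C) (@centreHom C) centre_id centre_comp _ _ _).
- move=> X Y f; apply: centreHom_eq; exact: comp_idl.
- move=> X Y f; apply: centreHom_eq; exact: comp_idr.
- move=> W X Y Z f g h; apply: centreHom_eq; exact: compA.
Defined.

End CentreCategory.

Section CentreTensor.
Variable C : strictMonCat.
Implicit Types Z W V : centreOb C.

(* (z|w)_X = (z_X ⊗ W) (Z ⊗ w_X), with identities inserted. *)
Definition tens_fam Z W (X : C) : Hom ((Z ⊗ W) ⊗ X) (X ⊗ (Z ⊗ W)) :=
  assoc X Z W ∘ (ce_hb Z X ⊗m idm W) ∘ assocV Z X W
  ∘ (idm Z ⊗m ce_hb W X) ∘ assoc Z W X.

Lemma tens_fam_heq Z W (X : C) :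
  tens_fam Z W X ≡
  (ce_hb Z X ⊗m idm W) ∘ assocV Z X W ∘ (idm Z ⊗m ce_hb W X).
Proof.
rewrite /tens_fam -!compA; apply: heq_trans; first exact: heq_idtl.
rewrite !compA; exact: heq_idtr.
Qed.

Lemma tens_fam_iso Z W (X : C) : is_iso (tens_fam Z W X).
Proof.
do 4 (apply: is_iso_comp; last first; first exact: is_iso_idt ||
  (apply: is_iso_tensm; exact: hb_iso || exact: is_iso_idm)).
exact: is_iso_idt.
Qed.

Lemma tens_fam_nat Z W (X Y : C) (f : Hom X Y) :
  (f ⊗m idm (Z ⊗ W)) ∘ tens_fam Z W X = tens_fam Z W Y ∘ (idm (Z ⊗ W) ⊗m f).
Proof.
have L : ((f ⊗m idm Z) ⊗m idm W) ∘ (ce_hb Z X ⊗m idm W) =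
    (ce_hb Z Y ⊗m idm W) ∘ ((idm Z ⊗m f) ⊗m idm W).
  by rewrite -!tensm_comp hb_nat.
have R : (idm Z ⊗m ce_hb W Y) ∘ (idm Z ⊗m (idm W ⊗m f)) =
    (idm Z ⊗m (f ⊗m idm W)) ∘ (idm Z ⊗m ce_hb W X).
  by rewrite -!tensm_comp hb_nat.
rewrite /tens_fam -!tensm_id !compA -assoc_nat -(compA _ _ (_ ⊗m idm W)) L.
rewrite -[in RHS]compA assoc_nat !compA -[in RHS](compA _ _ (_ ⊗m (_ ⊗m f))) R.
by rewrite !compA -(compA _ _ (assocV _ _ _)) -assocV_nat !compA.
Qed.

Lemma tens_fam_unit Z W : tens_fam Z W unito ≡ idm (Z ⊗ W).
Proof.
apply: heq_trans; first exact: tens_fam_heq.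
rewrite -(comp_idl (idm (Z ⊗ W))) -tensm_id.
apply: heq_comp_idt; apply: heq_tensm; try exact: heq_refl; exact: hb_unit.
Qed.

Lemma tens_fam_tens Z W (X Y : C) :
  tens_fam Z W (X ⊗ Y) ≡
  (idm X ⊗m tens_fam Z W Y) ∘ assoc X (Z ⊗ W) Y ∘ (tens_fam Z W X ⊗m idm Y).
Proof.
apply: heq_trans; first exact: tens_fam_heq.
have [e1 H1] := heq_whiskerr (ce_hb Z X ⊗m idm Y) (tensA X Z Y)
  (idm X ⊗m ce_hb Z Y) W.
have [e2 H2] := heq_whiskerl (ce_hb W X ⊗m idm Y) (tensA X W Y)
  (idm X ⊗m ce_hb W Y) Z.
have E1 : ce_hb Z (X ⊗ Y) ⊗m idm W ≡ _
  := heq_tensm (hb_tens (ce_hb Z) X Y) (heq_refl (idm (W : C))).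
have E2 : idm Z ⊗m ce_hb W (X ⊗ Y) ≡ _
  := heq_tensm (heq_refl (idm (Z : C))) (hb_tens (ce_hb W) X Y).
rewrite /assoc H1 in E1; rewrite /assoc H2 in E2.
have e3 : @eq C (Z ⊗ (X ⊗ (Y ⊗ W))) (((Z ⊗ X) ⊗ Y) ⊗ W) by rewrite !tensA.
apply: heq_trans; first exact: (heq_comp_idt2 _ e3 E2 E1).
have [e4 H4] := heq_whiskerr (idm Z ⊗m ce_hb W X) (eq_sym (tensA Z X W))
  (ce_hb Z X ⊗m idm W) Y.
have [e5 H5] := heq_whiskerl (idm Z ⊗m ce_hb W Y) (eq_sym (tensA Z Y W))
  (ce_hb Z Y ⊗m idm W) X.
have E4 : tens_fam Z W X ⊗m idm Y ≡ _
  := heq_tensm (tens_fam_heq Z W X) (heq_refl (idm (Y : C))).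
have E5 : idm X ⊗m tens_fam Z W Y ≡ _
  := heq_tensm (heq_refl (idm (X : C))) (tens_fam_heq Z W Y).
rewrite /assocV H4 in E4; rewrite /assocV H5 in E5.
apply: heq_sym.
have e6' : @eq C (((X ⊗ Z) ⊗ W) ⊗ Y) (X ⊗ (Z ⊗ (W ⊗ Y))) by rewrite !tensA.
apply: heq_trans; first exact: (heq_comp_idt2 _ e6' E4 E5).
apply: heq_sym.
have comp3 (X1 X2 X3 X4 X5 : C) (f1 : Hom X4 X5) (f2 : Hom X3 X4)
    (f3 : Hom X2 X3) (f4 : Hom X1 X2) :
    f1 ∘ f2 ∘ f3 ∘ f4 = f1 ∘ (f2 ∘ f3 ∘ f4) by rewrite !compA.
rewrite !compA (comp3 _ _ _ _ _ _ _ (idt e3)) (comp3 _ _ _ _ _ _ _ (idt e6')).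
apply: heq_comp_idt2; first exact: heq_sym (tensmA _ _ _).
apply: heq_comp_idt2; last exact: tensmA.
have E6 : (idm Z ⊗m (idm X ⊗m ce_hb W Y)) ≡ idm (Z ⊗ X) ⊗m ce_hb W Y.
  by rewrite -tensm_id; exact: heq_sym (tensmA _ _ _).
have E7 : (ce_hb Z X ⊗m idm Y) ⊗m idm W ≡ ce_hb Z X ⊗m idm (Y ⊗ W).
  by rewrite -tensm_id; exact: tensmA.
have E8 : (idm X ⊗m (idm Z ⊗m ce_hb W Y)) ≡ idm (X ⊗ Z) ⊗m ce_hb W Y.
  by rewrite -tensm_id; exact: heq_sym (tensmA _ _ _).
have E9 : (ce_hb Z X ⊗m idm W) ⊗m idm Y ≡ ce_hb Z X ⊗m idm (W ⊗ Y).
  by rewrite -tensm_id; exact: tensmA.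
apply: heq_trans; first exact: heq_comp_idt _ E6 E7.
apply: heq_sym; apply: heq_trans; first exact: heq_comp_idt _ E9 E8.
rewrite -!tensm_comp !comp_idl !comp_idr; exact: heq_refl.
Qed.

Definition tens_hb Z W : halfBraiding (Z ⊗ W) :=
  HalfBraiding (@tens_fam_iso Z W) (@tens_fam_nat Z W) (tens_fam_unit Z W)
    (tens_fam_tens Z W).

Definition centre_tens Z W : centreCat C := CentreOb (tens_hb Z W).

Definition centre_tensm (Z Z' W W' : centreCat C) (f : Hom Z Z')
  (g : Hom W W') : Hom (centre_tens Z W) (centre_tens Z' W').
Proof.
exists (ce_hom f ⊗m ce_hom g) => X.
have L : ((idm X ⊗m ce_hom f) ⊗m ce_hom g) ∘ (ce_hb Z X ⊗m idm W) =
    (ce_hb Z' X ⊗m idm W') ∘ ((ce_hom f ⊗m idm X) ⊗m ce_hom g).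
  by rewrite -!tensm_comp ce_compat comp_idl comp_idr.
have R : (idm Z' ⊗m ce_hb W' X) ∘ (ce_hom f ⊗m (ce_hom g ⊗m idm X)) =
    (ce_hom f ⊗m (idm X ⊗m ce_hom g)) ∘ (idm Z ⊗m ce_hb W X).
  by rewrite -!tensm_comp ce_compat comp_idl comp_idr.
rewrite /= /tens_fam !compA -assoc_nat -(compA _ _ (_ ⊗m idm W)) L.
rewrite -[in RHS]compA assoc_nat !compA -[in RHS](compA _ _ (_ ⊗m (_ ⊗m idm X))).
by rewrite R !compA -(compA _ _ (assocV _ _ _)) -assocV_nat !compA.
Defined.

Definition unit_fam (X : C) : Hom (unito ⊗ X) (X ⊗ unito) :=
  idt (eq_trans (tens1o X) (eq_sym (tenso1 X))).

Lemma unit_fam_nat (X Y : C) (f : Hom X Y) :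
  (f ⊗m idm unito) ∘ unit_fam X = unit_fam Y ∘ (idm unito ⊗m f).
Proof.
apply: heq_eq; apply: heq_trans; first exact: heq_idtr.
apply: heq_trans; first exact: tensmo1.
apply: heq_sym; apply: heq_trans; first exact: heq_idtl.
exact: tensm1o.
Qed.

Lemma unit_fam_heq (X : C) : unit_fam X ≡ idm X.
Proof.
apply: heq_trans; first exact: idt_heql.
apply: heq_idm; exact: tens1o.
Qed.

Lemma unit_fam_tens (X Y : C) :
  unit_fam (X ⊗ Y) ≡
  (idm X ⊗m unit_fam Y) ∘ assoc X unito Y ∘ (unit_fam X ⊗m idm Y).
Proof.
apply: heq_trans; first exact: unit_fam_heq.
apply: heq_sym; rewrite -[idm (X ⊗ Y)]comp_idl -tensm_id.
exact: heq_comp_idt _ (heq_tensm (unit_fam_heq X) (heq_refl _))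
  (heq_tensm (heq_refl _) (unit_fam_heq Y)).
Qed.

Definition unit_hb : halfBraiding (@unito C) :=
  HalfBraiding (fun X => is_iso_idt _) unit_fam_nat (unit_fam_heq unito)
    unit_fam_tens.

Definition centre_unit : centreCat C := CentreOb unit_hb.

Lemma centre_heq (Z W Z' W' : centreCat C) (f : Hom Z W) (g : Hom Z' W') :
  Z = Z' -> W = W' -> ce_hom f ≡ ce_hom g -> f ≡ g.
Proof.
move=> e e'; destruct e, e' => /heq_eq /centreHom_eq ->; exact: heq_refl.
Qed.

Lemma centre_tensA Z W V :
  centre_tens (centre_tens Z W) V = centre_tens Z (centre_tens W V).
Proof.
apply: centreOb_eq => [|X]; first exact: tensA.
apply: heq_trans; first exact: tens_fam_heq.
apply: heq_sym; apply: heq_trans; first exact: tens_fam_heq.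
have [e1 H1] := heq_whiskerr (idm Z ⊗m ce_hb W X) (eq_sym (tensA Z X W))
  (ce_hb Z X ⊗m idm W) V.
have [e2 H2] := heq_whiskerl (idm W ⊗m ce_hb V X) (eq_sym (tensA W X V))
  (ce_hb W X ⊗m idm V) Z.
have E1 : tens_fam Z W X ⊗m idm V ≡ _
  := heq_tensm (tens_fam_heq Z W X) (heq_refl (idm (V : C))).
have E2 : idm Z ⊗m tens_fam W V X ≡ _
  := heq_tensm (heq_refl (idm (Z : C))) (tens_fam_heq W V X).
rewrite /assocV H1 in E1; rewrite /assocV H2 in E2.
have e3 : @eq C (Z ⊗ ((X ⊗ W) ⊗ V)) ((Z ⊗ X) ⊗ (W ⊗ V)) by rewrite !tensA.
apply: heq_trans; first exact: heq_comp_idt2 _ e3 E2 (heq_refl _).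
have e4 : @eq C ((Z ⊗ W) ⊗ (X ⊗ V)) (((Z ⊗ (W ⊗ X)) ⊗ V)) by rewrite !tensA.
apply: heq_sym.
apply: heq_trans; first exact: heq_comp_idt2 _ e4 (heq_refl _) E1.
rewrite !compA; apply: heq_comp_idt2.
  by rewrite /= -tensm_id; exact: tensmA.
apply: heq_comp_idt2; first exact: tensmA.
by rewrite /= -tensm_id; exact: tensmA.
Qed.

Lemma centre_tens1o Z : centre_tens centre_unit Z = Z.
Proof.
apply: centreOb_eq => [|X]; first exact: tens1o.
apply: heq_trans; first exact: tens_fam_heq.
have E : ce_hb centre_unit X ⊗m idm Z ≡ idm (X ⊗ Z).
  by rewrite -tensm_id; exact: heq_tensm (unit_fam_heq X) (heq_refl _).
apply: heq_trans; first exact: heq_comp_idt _ (tensm1o (ce_hb Z X)) E.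
rewrite comp_idl; exact: heq_refl.
Qed.

Lemma centre_tenso1 Z : centre_tens Z centre_unit = Z.
Proof.
apply: centreOb_eq => [|X]; first exact: tenso1.
apply: heq_trans; first exact: tens_fam_heq.
have E : idm Z ⊗m ce_hb centre_unit X ≡ idm (Z ⊗ X).
  by rewrite -tensm_id; exact: heq_tensm (heq_refl _) (unit_fam_heq X).
apply: heq_trans; first exact: heq_comp_idt _ E (tensmo1 (ce_hb Z X)).
rewrite comp_idr; exact: heq_refl.
Qed.

End CentreTensor.

Definition centre (C : strictMonCat) : strictMonCat.
Proof.
refine (@StrictMonCat (centreCat C) (@centre_tens C) (@centre_tensm C)
  (centre_unit C) _ _ (@centre_tensA C) (@centre_tens1o C) (@centre_tenso1 C)
  _ _ _).
- move=> X Y; apply: centreHom_eq; exact: tensm_id.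
- move=> X X' X'' Y Y' Y'' f' f g' g; apply: centreHom_eq; exact: tensm_comp.
- move=> X X' Y Y' Z Z' f g h.
  by apply: centre_heq; [exact: centre_tensA | exact: centre_tensA
                        | exact: tensmA].
- move=> X X' f.
  by apply: centre_heq; [exact: centre_tens1o | exact: centre_tens1o
                        | exact: tensm1o].
- move=> X X' f.
  by apply: centre_heq; [exact: centre_tenso1 | exact: centre_tenso1
                        | exact: tensmo1].
Defined.

Section CentreBraiding.
Variable C : strictMonCat.

Lemma centre_is_iso (Z W : centreOb C) (f : centreHom Z W) :
  is_iso (ce_hom f) -> @is_iso (centre C) Z W f.
Proof.
move=> [g [gl gr]].
have h (X : C) : (idm X ⊗m g) ∘ ce_hb W X = ce_hb Z X ∘ (g ⊗m idm X).
  transitivity ((idm X ⊗m g) ∘ (ce_hb W X ∘ ((ce_hom f ⊗m idm X) ∘ (g ⊗m idm X)))).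
    by rewrite -tensm_comp gr comp_idl tensm_id comp_idr.
  by rewrite (compA (ce_hb W X)) -ce_compat !compA -tensm_comp gl comp_idl
    tensm_id comp_idl.
by exists (CentreHom h); split; apply: centreHom_eq.
Qed.

Lemma ce_hom_idt (Z W : centreOb C) (e : Z = W) :
  exists e' : @eq C Z W, ce_hom (@idt (centreCat C) Z W e) = idt e'.
Proof. by destruct e; exists eq_refl. Qed.

Definition centre_br (X Y : centreOb C) :
  @Hom (centre C) (centre_tens X Y) (centre_tens Y X).
Proof.
exists (ce_hb X Y) => V.
have H : ce_hb X (V ⊗ Y) ∘ (idm X ⊗m ce_hb Y V) =
    (ce_hb Y V ⊗m idm X) ∘ ce_hb X (Y ⊗ V) by rewrite -hb_nat.
apply: heq_eq; rewrite /= /tens_fam !compA.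
apply: heq_trans; first exact: heq_idtr.
apply: heq_trans.
  exact: heq_comp_idt _ (heq_refl _) (heq_sym (hb_tens (ce_hb X) V Y)).
rewrite H; apply: heq_sym.
rewrite -!compA; apply: heq_trans; first exact: heq_idtl.
rewrite (compA _ (assoc _ _ _)) (compA _ (assocV _ _ _)).
exact: heq_comp_idt _ (heq_sym (hb_tens (ce_hb X) Y V)) (heq_refl _).
Defined.

Definition centre_braiding : braiding (centre C).
Proof.
refine (@Braiding (centre C) centre_br _ _ _ _).
- move=> X Y; apply: centre_is_iso; exact: hb_iso.
- move=> X X' Y Y' f g; apply: centreHom_eq => /=.
  rewrite -[in LHS](comp_idl (ce_hom f)) -[in LHS](comp_idr (ce_hom g)).
  rewrite tensm_comp -compA ce_compat compA hb_nat -compA -tensm_comp.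
  by rewrite comp_idl comp_idr.
- move=> X Y Z; apply: centre_heq => [||/=].
  + by rewrite tensA.
  + by rewrite tensA.
  + have [e ->] := ce_hom_idt (tensA Y X Z : @eq (centreOb C) _ _).
    apply: heq_trans; first exact: hb_tens.
    exact: heq_comp_idt2 _ e (heq_refl _) (heq_refl _).
- move=> X Y Z; apply: centre_heq => [||/=].
  + by rewrite tensA.
  + by rewrite tensA.
  + have [e ->] := ce_hom_idt (eq_sym (tensA X Z Y) : @eq (centreOb C) _ _).
    apply: heq_trans; first exact: tens_fam_heq.
    exact: heq_comp_idt2 _ e (heq_refl _) (heq_refl _).
Defined.

End CentreBraiding.

Section ForgetAlgebra.
Variable C : strictMonCat.

Lemma ce_heq (Z W Z' W' : centre C) (f : Hom Z W) (g : Hom Z' W') :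
  f ≡ g -> ce_hom f ≡ ce_hom g.
Proof.
move=> [p [q ->]]; destruct p, q.
rewrite /= comp_idl comp_idr; exact: heq_refl.
Qed.

(* The forgetful functor from the centre to C is strict monoidal on the nose, so
   the structure morphisms need no transport. *)
Definition forget_str (Z : centre C) (S : algStruct Z) : algStruct (ce_ob Z) :=
  AlgStruct (C := C) (A := ce_ob Z) (alg_mul := ce_hom (alg_mul S))
    (alg_unit := ce_hom (alg_unit S))
    (ce_heq (alg_mulA S)) (ce_heq (alg_mul1l S)) (ce_heq (alg_mul1r S)).

Definition forget_alg (B : algebra (centre C)) : algebra C :=
  Algebra (forget_str (alg_str B)).

End ForgetAlgebra.

Section FullCentre.
Variables (C : strictMonCat) (A : algebra C).

Record centralPair := CentralPair {
  cp_ob :> centre C;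
  cp_map : @Hom C (ce_ob cp_ob) A;
  cp_central :
    mul A ∘ (cp_map ⊗m idm A) = mul A ∘ (idm A ⊗m cp_map) ∘ ce_hb cp_ob A
}.

Record centralHom (P Q : centralPair) := CentralHom {
  ch_hom : @Hom (centre C) P Q;
  ch_compat : cp_map Q ∘ ce_hom ch_hom = cp_map P
}.

Lemma centralHom_eq (P Q : centralPair) (f g : centralHom P Q) :
  ch_hom f = ch_hom g -> f = g.
Proof.
case: f => f hf; case: g => g hg /= e; destruct e.
by rewrite (proof_irrelevance _ hf hg).
Qed.

Definition centralId (P : centralPair) : centralHom P P :=
  CentralHom (ch_hom := idm (P : centre C)) (comp_idr (cp_map P)).

Definition centralComp (P Q R : centralPair) (g : centralHom Q R)
  (f : centralHom P Q) : centralHom P R.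
Proof.
exists (ch_hom g ∘ ch_hom f).
by rewrite /= compA !ch_compat.
Defined.

Definition centralCat : category.
Proof.
refine (@Category centralPair centralHom centralId centralComp _ _ _).
- move=> X Y f; apply: centralHom_eq; exact: comp_idl.
- move=> X Y f; apply: centralHom_eq; exact: comp_idr.
- move=> W X Y Z f g h; apply: centralHom_eq; exact: compA.
Defined.

Definition is_full_centre (P : centralPair) : Prop := @is_terminal centralCat P.

End FullCentre.

(* Main.v *)
(** Central pairs are closed under products: if [f : Z -> A] and [g : W -> A]
    are central then so is [mul A ∘ (f ⊗m g)] on [Z ⊗ W], and [one A] is central
    on the unit.  Terminality of the full centre turns these into the
    multiplication and unit, and all axioms (as well as uniqueness and
    commutativity) hold because two morphisms of the monoidal centre into the
    full centre agree as soon as their composites with [zeta] do. *)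

From Stdlib Require Import ssreflect ProofIrrelevance.
Require Import Defs.

Local Open Scope cat_scope.

Lemma algStruct_eq (C : strictMonCat) (A : C) (S T : algStruct A) :
  alg_mul S = alg_mul T -> alg_unit S = alg_unit T -> S = T.
Proof.
case: S => m u a l r; case: T => m' u' a' l' r' /= em eu; destruct em, eu.
by rewrite (proof_irrelevance _ a a') (proof_irrelevance _ l l')
  (proof_irrelevance _ r r').
Qed.

Section AlgebraLaws.
Variables (C : strictMonCat) (A : algebra C).

Lemma mul_assoc :
  mul A ∘ (mul A ⊗m idm A) = mul A ∘ (idm A ⊗m mul A) ∘ assoc A A A.
Proof.
apply: heq_eq; apply: heq_trans; first exact: alg_mulA.
exact: heq_sym (heq_idtr _ _).
Qed.

Lemma mul_assocV :
  mul A ∘ (idm A ⊗m mul A) = mul A ∘ (mul A ⊗m idm A) ∘ assocV A A A.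
Proof.
apply: heq_eq; apply: heq_trans; first exact: heq_sym (alg_mulA _).
exact: heq_sym (heq_idtr _ _).
Qed.

(** Associativity on generalised elements of [A]: naturality of [assoc] carries it past [f], [g] and
    [h]. *)
Lemma mul_tens3 {X Y Z : C} (f : Hom X A) (g : Hom Y A) (h : Hom Z A) :
  mul A ∘ ((mul A ∘ (f ⊗m g)) ⊗m h) =
  mul A ∘ (f ⊗m (mul A ∘ (g ⊗m h))) ∘ assoc X Y Z.
Proof.
rewrite -{1}(comp_idl h) tensm_comp compA mul_assoc.
rewrite -(compA _ (assoc _ _ _)) assoc_nat !compA.
by rewrite -(compA (mul A)) -tensm_comp comp_idl.
Qed.

Lemma mul_tens3V {X Y Z : C} (f : Hom X A) (g : Hom Y A) (h : Hom Z A) :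
  mul A ∘ (f ⊗m (mul A ∘ (g ⊗m h))) =
  mul A ∘ ((mul A ∘ (f ⊗m g)) ⊗m h) ∘ assocV X Y Z.
Proof.
rewrite -{1}(comp_idl f) tensm_comp compA mul_assocV.
rewrite -(compA _ (assocV _ _ _)) assocV_nat !compA.
by rewrite -(compA (mul A)) -tensm_comp comp_idl.
Qed.

Lemma mul_one_tens {X : C} (f : Hom X A) : mul A ∘ (one A ⊗m f) ≡ f.
Proof.
have -> : one A ⊗m f = (one A ⊗m idm A) ∘ (idm unito ⊗m f).
  by rewrite -tensm_comp comp_idl comp_idr.
rewrite compA -{2}(comp_idl f).
apply: heq_comp; [exact: tensm1o | exact: alg_mul1l].
Qed.

Lemma mul_tens_one {X : C} (f : Hom X A) : mul A ∘ (f ⊗m one A) ≡ f.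
Proof.
have -> : f ⊗m one A = (idm A ⊗m one A) ∘ (f ⊗m idm unito).
  by rewrite -tensm_comp comp_idl comp_idr.
rewrite compA -{2}(comp_idl f).
apply: heq_comp; [exact: tensmo1 | exact: alg_mul1r].
Qed.

End AlgebraLaws.

(** The condition [cp_central] outside its record, so that it can be proved before a central pair is
    formed. *)
Definition is_central {C : strictMonCat} (A : algebra C) (Z : centre C)
    (f : @Hom C (ce_ob Z) A) : Prop :=
  mul A ∘ (f ⊗m idm A) = mul A ∘ (idm A ⊗m f) ∘ ce_hb Z A.

Section Central.
Variables (C : strictMonCat) (A : algebra C).

(** The half-braiding of the unit is an identity transport, so both sides reduce to [idm A] by the
    unit laws. *)
Lemma is_central_one : is_central A (@unito (centre C)) (one A).
Proof.
apply: heq_eq; apply: heq_trans; first exact: alg_mul1l.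
apply: heq_sym; apply: heq_trans; first exact: heq_idtr.
exact: alg_mul1r.
Qed.

(** The half-braiding of [Z ⊗ W] carries [A] first past [W], which [hg] absorbs, and then past [Z],
    which [hf] absorbs; associativity regroups the factors in between. *)
Lemma is_central_tens {Z W : centre C} {f : @Hom C (ce_ob Z) A}
    {g : @Hom C (ce_ob W) A} :
  is_central A Z f -> is_central A W g ->
  is_central A (Z ⊗ W) (mul A ∘ (f ⊗m g)).
Proof.
rewrite /is_central => hf hg.
rewrite mul_tens3 hg /= /tens_fam !compA; congr (_ ∘ _).
have -> : f ⊗m (mul A ∘ (idm A ⊗m g) ∘ ce_hb W A) =
    (f ⊗m (mul A ∘ (idm A ⊗m g))) ∘ (idm _ ⊗m ce_hb W A).
  by rewrite -tensm_comp comp_idr.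
rewrite compA; congr (_ ∘ _).
rewrite mul_tens3V; congr (_ ∘ _).
by rewrite hf -mul_tens3 -[in RHS]compA -tensm_comp comp_idr.
Qed.

Lemma is_central_comp {Z W : centre C} {f : @Hom C (ce_ob Z) A}
    (h : Hom W Z) :
  is_central A Z f -> is_central A W (f ∘ ce_hom h).
Proof.
rewrite /is_central => hf.
have -> : (f ∘ ce_hom h) ⊗m idm A = (f ⊗m idm A) ∘ (ce_hom h ⊗m idm A).
  by rewrite -tensm_comp comp_idl.
have -> : idm A ⊗m (f ∘ ce_hom h) = (idm A ⊗m f) ∘ (idm A ⊗m ce_hom h).
  by rewrite -tensm_comp comp_idl.
by rewrite compA hf -!compA ce_compat.
Qed.

(** Naturality of the half-braiding of [Z] along [g] reduces this to the centrality of [f]. *)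
Lemma is_central_mul_br {Z W : centre C} {f : @Hom C (ce_ob Z) A}
    (g : @Hom C (ce_ob W) A) :
  is_central A Z f ->
  mul A ∘ (g ⊗m f) ∘ ce_hb Z (ce_ob W) = mul A ∘ (f ⊗m g).
Proof.
rewrite /is_central => hf.
have -> : g ⊗m f = (idm A ⊗m f) ∘ (g ⊗m idm (ce_ob Z)).
  by rewrite -tensm_comp comp_idl comp_idr.
rewrite -!compA hb_nat !compA -hf.
by rewrite -compA -tensm_comp comp_idl comp_idr.
Qed.

End Central.

Section FullCentreUniversal.
Context {C : strictMonCat} {A : algebra C} {P : centralPair A}.
Context (hP : is_full_centre P).

Lemma full_centre_lift {W : centre C} {g : @Hom C (ce_ob W) A} :
  is_central A W g ->
  exists h : Hom W (cp_ob P), cp_map P ∘ ce_hom h = g.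
Proof.
by move=> hg; have [[h hh] _] := hP (CentralPair hg); exists h.
Qed.

(** Stated with [≡] because the sides of an algebra axiom have sources that are equal only
    propositionally, such as the two bracketings of a triple product. *)
Lemma full_centre_mono {W W' : centre C} (h : Hom W (cp_ob P))
    (h' : Hom W' (cp_ob P)) :
  W = W' -> cp_map P ∘ ce_hom h ≡ cp_map P ∘ ce_hom h' -> h ≡ h'.
Proof.
move=> e; destruct e => /heq_eq E; apply: heq_of_eq.
(* Both [h] and [h'] are morphisms of central pairs from [Q] to the terminal [P]. *)
pose Q := CentralPair (is_central_comp C A h' (cp_central P)).
have [k hk] := hP Q.
have e1 := hk (CentralHom (P := Q) (Q := P) (ch_hom := h) E).
have e2 := hk (CentralHom (P := Q) (Q := P) (ch_hom := h') eq_refl).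
exact: (f_equal (fun x : centralHom Q P => ch_hom x)
  (eq_trans e1 (eq_sym e2))).
Qed.

End FullCentreUniversal.

Theorem proposition4p1 (C : strictMonCat) (A : algebra C)
    (P : centralPair A) (hP : is_full_centre P) :
  let Z := cp_ob P in
  let zeta := cp_map P in
  (exists! S : algStruct Z,
     is_alg_hom (A := forget_alg (Algebra S)) (B := A) zeta)
  /\ (forall S : algStruct Z,
        is_alg_hom (A := forget_alg (Algebra S)) (B := A) zeta ->
        is_commutative (centre_braiding C) (Algebra S)).
Proof.
move=> Z zeta; have zC : is_central A Z zeta := cp_central P.
split; last first.
  move=> S [hm _]; apply: heq_eq; apply: (full_centre_mono hP) => //.
  (* The braiding of [Z] with itself is the half-braiding of [Z] at [Z], so centrality of [zeta]
     suffices. *)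
  apply: heq_of_eq; rewrite /= compA; rewrite /mul /= -/zeta in hm *.
  rewrite hm; exact: is_central_mul_br.
have [m hm] := full_centre_lift hP (is_central_tens C A zC zC).
have [u hu] := full_centre_lift hP (is_central_one C A).
rewrite -/zeta in hm hu.
have mA : m ∘ (m ⊗m idm Z) ≡ m ∘ (idm Z ⊗m m).
  apply: (full_centre_mono hP); first exact: tensA.
  rewrite /= !compA hm -!compA -!tensm_comp hm comp_idr mul_tens3.
  exact: heq_idtr.
have m1l : m ∘ (u ⊗m idm Z) ≡ idm Z.
  apply: (full_centre_mono hP); first exact: tens1o.
  rewrite /= compA hm -compA -tensm_comp hu !comp_idr.
  exact: mul_one_tens.
have m1r : m ∘ (idm Z ⊗m u) ≡ idm Z.
  apply: (full_centre_mono hP); first exact: tenso1.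
  rewrite /= compA hm -compA -tensm_comp hu !comp_idr.
  exact: mul_tens_one.
exists (AlgStruct mA m1l m1r); split; first by split.
(* The homomorphism equations for [T] prescribe the composites of its operations with [zeta]. *)
move=> T [hTm hTu]; apply: algStruct_eq; apply: heq_eq;
  apply: (full_centre_mono hP) => //; apply: heq_of_eq.
- by rewrite hm -hTm.
- by rewrite hu -hTu.
Qed.
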